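(* Let $A$ and $B$ be (possibly unbounded) linear operators in a Hilbert space $\mathcal{X}$ such that $A$, $B$ and $A+B$ generate strongly continuous semigroups $\mathrm{e}^{tA}$, $\mathrm{e}^{tB}$ and $\mathrm{e}^{t(A+B)}$, $t\ge0$, with finite logarithmic norms $\mu[A]$, $\mu[B]$, $\mu[A+B]$, and suppose that $[A,[A,B]]$ and $[B,[A,B]]$ are bounded. Let $\omega=\mu[A]+\mu[B]-\mu[A+B]$. Then the error $E_{\mathrm{S}}(A,B;t)=\mathrm{e}^{\frac12 tA}\mathrm{e}^{tB}\mathrm{e}^{\frac12 tA}-\mathrm{e}^{t(A+B)}$ of the Strang splitting satisfies, for every $t\ge0$, $$\|E_{\mathrm{S}}(A,B;t)\|\le\frac14\,\mathrm{e}^{t\mu[A+B]}\,\frac{\left(1-\omega t+\frac12\omega^2t^2\right)\mathrm{e}^{\omega t}-1}{\omega^3}\,\bigl(\|[A,[A,B]]\|+2\|[B,[A,B]]\|\bigr),$$ where for $\omega=0$ the fraction is replaced by its limit $\tfrac16t^3$ as $\omega\to0$. In particular, if $\mu[A]=\mu[B]=\mu[A+B]=0$, then $$\|E_{\mathrm{S}}(A,B;t)\|\le\frac{t^3}{24}\bigl(\|[A,[A,B]]\|+2\|[B,[A,B]]\|\bigr).$$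
   Context: The commutator is $[P,Q]=PQ-QP$. The logarithmic norm of an operator $C$ is $\mu[C]=\lim_{\varepsilon\downarrow0}\frac{\|I+\varepsilon C\|-1}{\varepsilon}$ for bounded $C$; in general, for a generator $C$ of a strongly continuous semigroup on $\mathcal{X}$, it is characterized as the least number such that $\|\mathrm{e}^{tC}\|\le\mathrm{e}^{t\mu[C]}$ for all $t\ge0$. Convention: operator identities are understood as applied to elements $u\in\mathcal{X}$, or to those $u$ in a subset of $\mathcal{X}$, for which the operator products, commutators, derivatives and integrals involved are defined.
   Formalization: It is additionally assumed that the set of u for which the products, commutators and derivatives along e^{pA}e^{qB}e^{sA}u in the error representation are defined is dense in X; without this the bound fails, e.g. A=d/dx on the circle, B=multiplication by ix on (0,1). *)

(* Defs.v *)
From HB Require Import structures.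
From mathcomp Require Import all_boot all_order all_algebra.
From mathcomp Require Export sesquilinear.
From mathcomp Require Import all_classical all_reals all_analysis.
Set Implicit Arguments.
Unset Strict Implicit.
Unset Printing Implicit Defensive.
Import Order.TTheory GRing.Theory Num.Theory.
Import numFieldNormedType.Exports.
Local Open Scope classical_set_scope.
Local Open Scope ring_scope.

(* Scalars are real. A complex Hilbert space is covered through its underlying
   real space with the inner product Re <.,.>: complex-linear operators are
   real-linear, and the norm, domains, density, operator norms and limits over
   real t used below are unchanged by this restriction of scalars. *)

Section Operators.
Variables (R : realType) (X : completeNormedModType R).

Definition hilbert_inner_product (ip : {dot X for @idfun R}) : Prop :=
  forall u, `|u| ^+ 2 = ip u u.

(* Possibly unbounded operator: [opfun] is meaningful on [opdom] only. *)
Record operator : Type := Operator { opdom : set X ; opfun :> X -> X }.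

Definition linear_operator (P : operator) : Prop :=
  opdom P 0 /\
  forall (a : R) (u v : X), opdom P u -> opdom P v ->
    opdom P (a *: u + v) /\ P (a *: u + v) = a *: P u + P v.

(* Sums, products and commutators carry their natural (maximal) domains. *)
Definition op_add (P Q : operator) : operator :=
  Operator (opdom P `&` opdom Q) (fun u => P u + Q u).

Definition op_mul (P Q : operator) : operator :=
  Operator [set u | opdom Q u /\ opdom P (Q u)] (fun u => P (Q u)).

Definition commutator (P Q : operator) : operator :=
  Operator (opdom (op_mul P Q) `&` opdom (op_mul Q P))
           (fun u => P (Q u) - Q (P u)).

(* Extended-real valued, so that it is +oo for an unbounded operator. *)
Definition opnorm (P : operator) : \bar R :=
  ereal_sup [set (`|P u|)%:E | u in [set u | opdom P u /\ `|u| <= 1]].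

Definition op_bounded (P : operator) : Prop :=
  exists M : R, forall u, opdom P u -> `|P u| <= M * `|u|.

Definition everywhere (f : X -> X) : operator := Operator setT f.

(* The values [S t] for t < 0 are irrelevant. *)
Definition C0_semigroup (S : R -> X -> X) : Prop :=
  [/\ forall t, 0 <= t -> linear (S t) /\ continuous (S t),
      S 0 = id,
      forall s t, 0 <= s -> 0 <= t -> S (s + t) = S s \o S t &
      forall u, S t u @[t --> 0^'+] --> u].

(* S = (e^{tG}), t >= 0, including equality of the domains. *)
Definition generates (G : operator) (S : R -> X -> X) : Prop :=
  [/\ C0_semigroup S,
      forall u, opdom G u <-> cvg (h^-1 *: (S h u - u) @[h --> 0^'+]) &
      forall u, opdom G u -> h^-1 *: (S h u - u) @[h --> 0^'+] --> G u].

(* [is_log_norm S mu]: mu is the (finite) logarithmic norm mu[G] of the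
   generator G of S. *)
Definition is_log_norm (S : R -> X -> X) (mu : R) : Prop :=
  let growth nu := forall t, 0 <= t ->
    (opnorm (everywhere (S t)) <= (expR (t * nu))%:E)%E in
  growth mu /\ forall nu, growth nu -> mu <= nu.

Definition strang_error (SA SB SAB : R -> X -> X) (t : R) : operator :=
  everywhere (fun u => SA (t / 2) (SB t (SA (t / 2) u)) - SAB t u).

(* d/dt (K e^{tG} u) = K G e^{tG} u on [0, +oo[, one-sided at t = 0. *)
Definition differentiable_orbit
    (K G : operator) (S : R -> X -> X) (u : X) : Prop :=
  forall t, 0 <= t ->
    h^-1 *: (K (S (t + h) u) - K (S t u))
      @[h --> within [set h | 0 <= t + h] 0^'] --> K (G (S t u)).

(* The elements u for which the operator products, commutators and derivatives
   in the variation-of-constants representation of the splitting error are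
   defined: its terms apply A, B, [A,B], [A,[A,B]] and [B,[A,B]] to
   e^{pA} e^{qB} e^{sA} u, and differentiate B e^{pA}, [A,B] e^{pA} in p and
   A e^{qB}, [A,B] e^{qB} in q. It is all of X when A and B are bounded.
   Bounded double commutators say nothing about the splitting error unless this
   set is dense: for A = d/dx and B = multiplication by i 1_E on L^2(R), where E
   and its complement meet every interval in positive measure, the domain of
   [A,B] is {0}. *)
Definition strang_domain (A B : operator) (SA SB : R -> X -> X) : set X :=
  let AB := commutator A B in
  [set u | forall s, 0 <= s ->
    [/\ differentiable_orbit A B SB (SA s u),
        differentiable_orbit AB B SB (SA s u) &
        forall q, 0 <= q ->
          [/\ differentiable_orbit B A SA (SB q (SA s u)),
              differentiable_orbit AB A SA (SB q (SA s u)) &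
              forall p, 0 <= p ->
                opdom (commutator A AB) (SA p (SB q (SA s u))) /\
                opdom (commutator B AB) (SA p (SB q (SA s u)))]]].

End Operators.

Definition strang_factor (R : realType) (omega t : R) : R :=
  if omega == 0 then t ^+ 3 / 6
  else ((1 - omega * t + omega ^+ 2 * t ^+ 2 / 2) * expR (omega * t) - 1)
         / omega ^+ 3.

(* Main.v *)
(** For u in the strang domain, compare f(s) = e^{(t-s)(A+B)} S(s) u at s = 0 and
    s = t, where S(s) = e^{sA/2} e^{sB} e^{sA/2}. Its right derivative is
    e^{(t-s)(A+B)} applied to the defect
      S' u - (A+B) S u = [e^{sA/2}, B] e^{sB} e^{sA/2} u
                         + 1/2 e^{sA/2} [e^{sB}, A] e^{sA/2} u.
    Each commutator [e^{sG}, K] is expanded to second order around the term with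
    [A,B] next to e^{sB}; these terms cancel, and the remainders only involve the
    double commutators, whence
      |defect| <= s^2/8 e^{s(mu[A]+mu[B])} (|[A,[A,B]]| + 2 |[B,[A,B]]|) |u|.
    No vector-valued integral is needed: a mean value inequality for right
    derivatives replaces the variation-of-constants integrals, and the resulting
    scalar integral is [strang_factor] up to a constant. The bound extends to all
    of X by density. *)
Require Import Defs.
From mathcomp Require Import all_boot all_order all_algebra.
From mathcomp Require Import all_classical all_reals all_analysis.
From mathcomp Require Import lra ring.
Set Implicit Arguments.
Unset Strict Implicit.
Import Order.TTheory GRing.Theory Num.Theory.
Import numFieldNormedType.Exports.
Local Open Scope classical_set_scope.
Local Open Scope ring_scope.

Lemma near_cvg {T : Type} {U : topologicalType} {F : set_system T} {FF : Filter F}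
    (f g : T -> U) (l : U) :
  (\forall x \near F, f x = g x) -> f x @[x --> F] --> l -> g x @[x --> F] --> l.
Proof.
move=> fg; apply: cvg_trans; apply: near_eq_cvg.
by apply: filterS fg => x ->.
Qed.

(** * Mean value inequality and Taylor bounds for right derivatives *)

Section RightDerivative.
Context {R : realType} {V : normedModType R}.
Implicit Types (f : R -> V) (l : V).

Definition right_derivative f x l :=
  h^-1 *: (f (x + h) - f x) @[h --> 0^'+] --> l.

Definition left_continuous f x := f y @[y --> x^'-] --> f x.

(* The infimum of the points violating the estimate with slack [e] satisfies it by
   left continuity, and the right derivative there extends it a bit further. *)
Lemma right_derivative_norm_le (f : R -> V) (f' : R -> V) (g g' : R -> R) a b :
  a <= b ->
  (forall x, a < x <= b -> left_continuous f x) ->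
  (forall x, a <= x < b -> right_derivative f x (f' x)) ->
  (forall x : R, is_derive x 1 g (g' x)) ->
  (forall x, a <= x < b -> `|f' x| <= g' x) ->
  `|f b - f a| <= g b - g a.
Proof.
move=> ab fl fr gd f'g'.
have gc x : {for x, continuous g}.
  by apply: differentiable_continuous; apply/derivable1_diffP; apply: ex_derive.
(* The slack is linear in the elapsed time, so just after any point the allowed slope is strictly
   above [g']. Taking [e / (b - a)] makes it arbitrarily small at [b], which is why [a = b] is
   treated apart. *)
suff H e : 0 < e -> `|f b - f a| <= g b - g a + e * (b - a).
  move: ab; rewrite le_eqVlt => /predU1P[->|ab]; first by rewrite !subrr normr0.
  apply/ler_addgt0Pr => e e0.
  have := H (e / (b - a)); rewrite divfK ?subr_eq0 ?gt_eqF//; apply.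
  by rewrite divr_gt0// subr_gt0.
move=> e0.
pose bad := [set x | a <= x <= b /\ g x - g a + e * (x - a) < `|f x - f a|].
rewrite leNgt; apply/negP => badb.
have bad0 : bad !=set0 by exists b; split=> //; rewrite ab lexx.
have badlb : lbound bad a by move=> x [/andP[]].
have hbad : has_inf bad by split=> //; exists a.
pose m := inf bad.
have am : a <= m by exact: lb_le_inf.
have mb : m <= b by apply: ge_inf; [exists a|split=> //; rewrite ab lexx].
have good x : a <= x < m -> `|f x - f a| <= g x - g a + e * (x - a).
  move=> /andP[ax xm]; rewrite leNgt; apply/negP => bx.
  have : m <= x.
    by apply: ge_inf; [exists a|split=> //; rewrite ax (le_trans (ltW xm))].
  by rewrite leNgt xm.
have goodm : `|f m - f a| <= g m - g a + e * (m - a).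
  move: (am); rewrite le_eqVlt => /predU1P[<-|am'].
    by rewrite !subrr normr0 mulr0 addr0.
  have cl : `|f x - f a| @[x --> m^'-] --> `|f m - f a|.
    apply: cvg_norm; apply: cvgB; last exact: cvg_cst.
    by apply: fl; rewrite am'.
  have cr : g x - g a + e * (x - a) @[x --> m^'-] --> g m - g a + e * (m - a).
    apply: cvgD.
      by apply: cvgB; [apply: cvg_at_left_filter; exact: gc|exact: cvg_cst].
    apply: cvgM; first exact: cvg_cst.
    apply: cvgB; last exact: cvg_cst.
    apply: cvg_at_left_filter; exact: cvg_id.
  apply: (ler_cvg_to cl cr).
  near=> x; apply: good; apply/andP; split; near: x.
    by apply: nbhs_left_ge.
  exact: nbhs_left_lt.
move: (mb); rewrite le_eqVlt => /predU1P[mb'|mb'].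
  by move: goodm; rewrite mb' leNgt badb.
have fm : a <= m < b by rewrite am.
have gr : h^-1 *: (g (m + h) - g m) @[h --> 0^'+] --> (g' m : R^o).
  have [gm <-] := gd m.
  have -> : (fun h => h^-1 *: (g (m + h) - g m : R^o)) =
      (fun h => h^-1 *: ((g \o shift m) (h *: 1) - g m)).
    by apply/funext => h /=; rewrite [m + h]addrC [h *: 1]mulr1.
  by apply: cvg_dnbhs_at_right; exact: gm.
have near_lt : \forall h \near 0^'+,
    `|h^-1 *: (f (m + h) - f m)| - h^-1 *: (g (m + h) - g m) < e.
  apply: cvgr_lt; first by apply: cvgB; [apply: cvg_norm; exact: fr|exact: gr].
  by rewrite (le_lt_trans _ e0)// subr_le0 f'g'.
have [d /= d0 dP] : \forall h \near 0^'+,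
    `|f (m + h) - f a| <= g (m + h) - g a + e * (m + h - a).
  near=> h.
  have h0 : 0 < h by near: h; exact: nbhs_right_gt.
  have : `|h^-1 *: (f (m + h) - f m)| - h^-1 *: (g (m + h) - g m) < e by near: h.
  rewrite normrZ gtr0_norm ?invr_gt0// [_ *: _]/(_ * _) -mulrBr.
  rewrite mulrC ltr_pdivrMr// => /ltW.
  have -> : f (m + h) - f a = (f (m + h) - f m) + (f m - f a) by rewrite addrA subrK.
  move=> H1; apply: (le_trans (ler_normD _ _)); move: goodm H1.
  set P := `| _ |; set Q := `|_|; move: (g (m+h)) (g m) (g a) => *; lra.
(* Some violating point lies within [d] of the infimum, where the estimate has just been shown to
   hold. *)
have [x bx xm] := inf_adherent d0 hbad.
have mx : m <= x by apply: ge_inf => //; exists a.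
have [_] := bx; apply/negP; rewrite -leNgt.
move: mx; rewrite le_eqVlt => /predU1P[<-//|mx].
rewrite -(subrK m x) [x - m + m]addrC; apply: dP => //=; last by rewrite subr_gt0.
by rewrite /= sub0r normrN gtr0_norm ?subr_gt0// ltrBlDl.
Unshelve. all: by end_near. Qed.


Lemma right_derivativeB f1 f2 x l1 l2 :
  right_derivative f1 x l1 -> right_derivative f2 x l2 ->
  right_derivative (fun y => f1 y - f2 y) x (l1 - l2).
Proof.
move=> d1 d2; apply: near_cvg (cvgB d1 d2).
by near=> h; rewrite -scalerBr !opprD !opprK addrACA.
Unshelve. all: by end_near. Qed.

Lemma right_derivativeZ f x l c :
  right_derivative f x l -> right_derivative (fun y => c *: f y) x (c *: l).
Proof.
move=> d; apply: near_cvg (cvgZ (cvg_cst c) d).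
by near=> h; rewrite -scalerBr !scalerA mulrC.
Unshelve. all: by end_near. Qed.

Lemma right_derivative_scale (c : V) x : right_derivative ( *:%R^~ c) x c.
Proof.
apply: (near_cvg (f := fun=> c)); last exact: cvg_cst.
near=> h; rewrite -scalerBl addrAC subrr add0r scalerA mulVf ?scale1r//.
Unshelve. all: by end_near. Qed.

Lemma right_derivative_cst (c : V) x : right_derivative (fun=> c) x 0.
Proof.
apply: (near_cvg (f := fun=> 0)); last exact: cvg_cst.
by apply: nearW => h; rewrite subrr scaler0.
Qed.

(** The mean value inequality, applied to [g], makes [g] Lipschitz with constant [m]; applied to
    [f x - x *: c], with [c] the value of [g] at either endpoint, it then integrates this Lipschitz
    bound. Both endpoints are needed: the two commutators in the defect are expanded at opposite
    ends. *)
Lemma right_taylor (f g g' : R -> V) (m a b : R) : a <= b ->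
  (forall x, a < x <= b -> left_continuous f x /\ left_continuous g x) ->
  (forall x, a <= x < b -> right_derivative f x (g x)) ->
  (forall x, a <= x < b -> right_derivative g x (g' x)) ->
  (forall x, a <= x < b -> `|g' x| <= m) ->
  `|f b - f a - (b - a) *: g a| <= m * (b - a) ^+ 2 / 2 /\
  `|f b - f a - (b - a) *: g b| <= m * (b - a) ^+ 2 / 2.
Proof.
move=> ab fg fd gd g'm.
have lip x y : a <= x -> x <= y -> y <= b -> `|g y - g x| <= m * (y - x).
  move=> ax xy yb; rewrite mulrBr.
  apply: (@right_derivative_norm_le g g' ( *%R m) (fun=> m)) => // z.
  - by move=> /andP[xz zy]; apply fg; rewrite (le_lt_trans ax)//= (le_trans zy).
  - by move=> /andP[xz zy]; apply: gd; rewrite (le_trans ax)//= (lt_le_trans zy).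
  - by apply: is_derive_eq; rewrite [_ *: _]mulr1.
  - by move=> /andP[xz zy]; apply: g'm; rewrite (le_trans ax)//= (lt_le_trans zy).
have key c (k k' : R -> R) : (forall x : R, is_derive x 1 k (k' x)) ->
    (forall x, a <= x < b -> `|g x - c| <= k' x) ->
    `|f b - f a - (b - a) *: c| <= k b - k a.
  move=> kd gk.
  have -> : f b - f a - (b - a) *: c = (f b - b *: c) - (f a - a *: c).
    by rewrite scalerBl !opprD !opprK addrACA.
  apply: (@right_derivative_norm_le (fun x => f x - x *: c)
    (fun x => g x - c) k k') => // x xab.
    have xl : y @[y --> x^'-] --> x by apply: cvg_at_left_filter; exact: cvg_id.
    exact: cvgB (fg _ xab).1 (cvgZ xl (cvg_cst c)).
  by apply: right_derivativeB; [exact: fd|exact: right_derivative_scale].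
split.
- have := key (g a) (fun x => m * (x - a) ^+ 2 / 2) (fun x => m * (x - a)).
  rewrite subrr expr0n mulr0 mul0r subr0; apply.
    by move=> x; apply: is_derive_eq; rewrite /GRing.scale/=; field.
  by move=> x /andP[ax xb]; apply: lip => //; exact: ltW.
- have := key (g b) (fun x => - (m * (b - x) ^+ 2 / 2)) (fun x => m * (b - x)).
  rewrite subrr expr0n mulr0 mul0r oppr0 sub0r opprK; apply.
    by move=> x; apply: is_derive_eq; rewrite /GRing.scale/=; field.
  by move=> x /andP[ax xb]; rewrite distrC; apply: lip => //; exact: ltW.
Qed.

End RightDerivative.

(** * Unbounded linear operators and the operator norm *)

Section Operators.
Context {R : realType} {X : completeNormedModType R}.
Implicit Types (P Q G : operator X) (S : R -> X -> X).

Lemma linear_operatorD P u v : linear_operator P -> opdom P u -> opdom P v ->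
  opdom P (u + v) /\ P (u + v) = P u + P v.
Proof.
by move=> [_ Pl] Pu Pv; have := Pl 1 _ _ Pu Pv; rewrite !scale1r.
Qed.

Lemma linear_operator0 P : linear_operator P -> P 0 = 0.
Proof.
move=> Pl; have P0 := Pl.1; have [_] := linear_operatorD Pl P0 P0.
by rewrite addr0 => /(congr1 (fun x => x - P 0)); rewrite subrr addrK.
Qed.

Lemma linear_operatorZ P a u : linear_operator P -> opdom P u ->
  opdom P (a *: u) /\ P (a *: u) = a *: P u.
Proof.
move=> Pl Pu; have [P0 Pz] := Pl; have := Pz a _ _ Pu P0.
by rewrite linear_operator0// !addr0.
Qed.

Lemma linear_operator_mul P Q : linear_operator P -> linear_operator Q ->
  linear_operator (op_mul P Q).
Proof.
move=> Pl Ql; split.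
  by split; [exact: Ql.1|rewrite linear_operator0//; exact: Pl.1].
move=> a u v [Qu PQu] [Qv PQv] /=.
have [Qw ->] := Ql.2 a _ _ Qu Qv.
by have [Pw ->] := Pl.2 a _ _ PQu PQv.
Qed.

Lemma linear_operator_commutator P Q : linear_operator P -> linear_operator Q ->
  linear_operator (commutator P Q).
Proof.
move=> Pl Ql.
have [[Q0 PQ0] PQ] := linear_operator_mul Pl Ql.
have [[P0 QP0] QP] := linear_operator_mul Ql Pl.
split=> // a u v [PQu QPu] [PQv QPv] /=.
have [PQw /= ->] := PQ a _ _ PQu PQv; have [QPw /= ->] := QP a _ _ QPu QPv.
by split=> //; rewrite scalerBr opprD addrACA.
Qed.

Lemma linear_operator_everywhere (f : X -> X) : linear f ->
  linear_operator (everywhere f).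
Proof. by move=> fl; split=> // a u v _ _; split=> //; exact: fl. Qed.

Lemma opnorm_le P (M : R) : 0 <= M -> (forall u, opdom P u -> `|P u| <= M * `|u|) ->
  (opnorm P <= M%:E)%E.
Proof.
move=> M0 PM; apply: ge_ereal_sup => _ [u [Pu u1] <-]; rewrite lee_fin.
by rewrite (le_trans (PM _ Pu))// ler_piMr.
Qed.

Lemma opnorm_ge0 P : linear_operator P -> (0 <= opnorm P)%E.
Proof.
move=> Pl; apply: ereal_sup_ubound; exists 0; last by rewrite linear_operator0// normr0.
by split; [exact: Pl.1|rewrite normr0].
Qed.

Lemma norm_le_opnorm P (M : R) u : linear_operator P -> (opnorm P <= M%:E)%E ->
  opdom P u -> `|P u| <= M * `|u|.
Proof.
move=> Pl PM Pu; have [->|u0] := eqVneq u 0.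
  by rewrite linear_operator0// !normr0 mulr0.
have n0 : 0 < `|u| by rewrite normr_gt0.
have [Pv Pve] := linear_operatorZ (`|u|^-1) Pl Pu.
rewrite -ler_pdivrMr// mulrC.
suff : (`|P (`|u|^-1 *: u)|%:E <= M%:E)%E.
  by rewrite lee_fin Pve normrZ normfV normr_id.
apply: le_trans PM; apply: ereal_sup_ubound; exists (`|u|^-1 *: u) => //.
by split=> //; rewrite normrZ normfV normr_id mulVf// gt_eqF.
Qed.

Lemma opnorm_fin P : linear_operator P -> op_bounded P ->
  exists M : R, 0 <= M /\ opnorm P = M%:E.
Proof.
move=> Pl [M PM]; have P0 := opnorm_ge0 Pl.
(* The constant in [op_bounded] may be negative when the domain is trivial, hence the maximum with
   0. *)
have : (opnorm P <= (Num.max M 0)%:E)%E.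
  apply: opnorm_le; first by rewrite le_max lexx orbT.
  by move=> u Pu; rewrite (le_trans (PM _ Pu))// ler_wpM2r// le_max lexx.
case: (opnorm P) P0 => [r| |]//; rewrite lee_fin => r0 _.
by exists r.
Qed.

End Operators.

(** * Strong continuity and product rules for semigroups *)

Section Semigroups.
Context {R : realType} {X : completeNormedModType R}.
Context (S : R -> X -> X) (mu : R).
Hypothesis S_semigroup : C0_semigroup S.
Hypothesis S_growth : forall t : R, 0 <= t ->
  (opnorm (everywhere (S t)) <= (expR (t * mu))%:E)%E.

Lemma semigroup_linear (t : R) : 0 <= t -> linear (S t).
Proof. by case: S_semigroup => Sl _ _ _ /Sl[]. Qed.

Lemma semigroupD (t s : R) u : 0 <= s -> 0 <= t -> S (s + t) u = S s (S t u).
Proof. by case: S_semigroup => _ _ SD _ s0 t0; rewrite SD. Qed.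

Lemma semigroup0 u : S 0 u = u.
Proof. by case: S_semigroup => _ -> _ _. Qed.

Lemma semigroupZ (t : R) a u : 0 <= t -> S t (a *: u) = a *: S t u.
Proof.
move=> /semigroup_linear/linear_operator_everywhere Sl.
by have [] := linear_operatorZ (P := everywhere (S t)) a Sl (u := u) I.
Qed.

Lemma semigroupB (t : R) u v : 0 <= t -> S t (u - v) = S t u - S t v.
Proof.
move=> t0; have /linear_operator_everywhere Sl := semigroup_linear t0.
have [_ /= ->] := linear_operatorD (P := everywhere (S t)) (u := u) (v := - v) Sl I I.
by rewrite -scaleN1r semigroupZ// scaleN1r.
Qed.

Lemma semigroup_norm_le (t : R) u : 0 <= t -> `|S t u| <= expR (t * mu) * `|u|.
Proof.
move=> t0; have Sl := linear_operator_everywhere (semigroup_linear t0).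
exact: (norm_le_opnorm (u := u) Sl (S_growth t0)).
Qed.

(** The absolute value turns one-sided continuity at 0 into a two-sided limit, which can be composed
    with a time increment of either sign. *)
Lemma semigroup_cvg0 u : S `|r| u @[r --> (0 : R)] --> u.
Proof.
case: S_semigroup => _ _ _ /(_ u)/cvgrPdist_lt Su.
apply/cvgrPdist_lt => e e0; have [d /= d0 dP] := Su _ e0.
exists d => //= r; rewrite /= sub0r normrN => rd.
have [->|r0] := eqVneq r 0; first by rewrite normr0 semigroup0 subrr normr0.
by apply: dP; rewrite /= ?normr_gt0// sub0r normrN normr_id.
Qed.

Lemma semigroup_cvg {T : Type} {F : set_system T} {FF : Filter F}
    (tau : T -> R) (y : T -> X) (tau0 : R) (y0 : X) :
  0 <= tau0 -> (\forall x \near F, 0 <= tau x) ->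
  tau x @[x --> F] --> tau0 -> y x @[x --> F] --> y0 ->
  S (tau x) (y x) @[x --> F] --> S tau0 y0.
Proof.
move=> tau00 tau_ge0 tauc yc; apply/subr_cvg0/norm_cvg0P.
have ec : expR (tau x * mu) @[x --> F] --> expR (tau0 * mu).
  by apply: continuous_cvg; [exact: continuous_expR|apply: cvgM tauc (cvg_cst _)].
have Sc : S `|tau x - tau0| y0 @[x --> F] --> y0.
  have tau_sub : tau x - tau0 @[x --> F] --> 0 by apply/subr_cvg0.
  exact: (cvg_comp _ _ tau_sub (@semigroup_cvg0 y0)).
(* The sum of the two exponentials dominates the growth factor of the smaller time, whichever of
   [tau x] and [tau0] that is. *)
pose k x := expR (tau x * mu) * `|y x - y0| +
  (expR (tau x * mu) + expR (tau0 * mu)) * `|S `|tau x - tau0| y0 - y0|.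
have k0 : k x @[x --> F] --> 0.
  have -> : 0 = expR (tau0 * mu) * `|0 : X| +
      (expR (tau0 * mu) + expR (tau0 * mu)) * `|0 : X|.
    by rewrite normr0 !mulr0 addr0.
  apply: cvgD; apply: cvgM; first exact: ec.
  + by apply: cvg_norm; apply/subr_cvg0.
  + by apply: cvgD ec (cvg_cst _).
  + by apply: cvg_norm; apply/subr_cvg0.
have kle : \forall x \near F, 0 <= `|S (tau x) (y x) - S tau0 y0| <= k x; last first.
  have c0 : (fun=> 0) x @[x --> F] --> (0 : R) by exact: cvg_cst.
  exact: (squeeze_cvgr kle c0 k0).
near=> x; have tx : 0 <= tau x by near: x.
  rewrite normr_ge0 /=.
  have -> : S (tau x) (y x) - S tau0 y0 =
      S (tau x) (y x - y0) + (S (tau x) y0 - S tau0 y0).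
    by rewrite semigroupB// addrA subrK.
  rewrite (le_trans (ler_normD _ _))// lerD ?semigroup_norm_le//.
  have [le|/ltW le] := leP tau0 (tau x).
  + rewrite ger0_norm ?subr_ge0// -{1}(subrK tau0 (tau x)) [_ + tau0]addrC.
    rewrite [S (tau0 + _) _]semigroupD ?subr_ge0// -semigroupB//.
    rewrite (le_trans (semigroup_norm_le _ _))// ler_wpM2r// lerDr.
    exact: expR_ge0.
  + rewrite distrC [`|tau x - _|]distrC ger0_norm ?subr_ge0//.
    rewrite -{1}(subrK (tau x) tau0) [_ + tau x]addrC.
    rewrite [S (tau x + _) _]semigroupD ?subr_ge0// -semigroupB//.
    rewrite (le_trans (semigroup_norm_le _ _))// ler_wpM2r// lerDl.
    exact: expR_ge0.
Unshelve. all: by end_near. Qed.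

Context (G : operator X).
Hypothesis S_generated : generates G S.

Lemma generator_cvg u (k : R) : 0 < k -> opdom G u ->
  h^-1 *: (S (k * h) u - u) @[h --> 0^'+] --> k *: G u.
Proof.
move=> k0 Gu; case: S_generated => _ _ /(_ _ Gu) SG.
have kh : k * h @[h --> 0^'+] --> 0^'+.
  move=> P [d /= d0 dP]; exists (d / k); first by rewrite /= divr_gt0.
  move=> h /=; rewrite sub0r normrN => hd h0.
  apply: dP; last by rewrite mulr_gt0.
  by rewrite /= sub0r normrN normrM gtr0_norm// -ltr_pdivlMl// mulrC.
apply: near_cvg (cvgZ (cvg_cst k) (cvg_comp _ _ kh SG)).
by near=> h; rewrite /= scalerA invfM mulrA mulfV ?gt_eqF// mul1r.
Unshelve. all: by end_near. Qed.

(** Both sides are limits of [S t (h^-1 *: (S h u - u))]: one because [S t] commutes with [S h], the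
    other by continuity of [S t]. *)
Lemma generator_commute (t : R) u : 0 <= t -> opdom G u -> opdom G (S t u) ->
  G (S t u) = S t (G u).
Proof.
move=> t0 Gu GSu; case: S_generated => _ _ SG.
have lhs := SG _ GSu.
have tn : \forall h \near (0 : R)^'+, 0 <= t by apply: filterE.
have tc : (fun=> t) h @[h --> (0:R)^'+] --> t by exact: cvg_cst.
have rhs : S t (h^-1 *: (S h u - u)) @[h --> 0^'+] --> S t (G u).
  exact: semigroup_cvg t0 tn tc (SG _ Gu).
have lhs2 : S t (h^-1 *: (S h u - u)) @[h --> 0^'+] --> G (S t u).
  apply: near_cvg lhs; near=> h.
  have h0 : 0 <= h by near: h; exact: nbhs_right_ge.
  by rewrite semigroupZ// semigroupB// -!semigroupD// [t + h]addrC.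
exact: (@cvg_unique _ (@norm_hausdorff _ X) _ _ _ _ lhs2 rhs).
Unshelve. all: by end_near. Qed.

(* [k] rescales time, as for the half steps of the splitting. *)
Lemma right_derivative_semigroup (k s : R) (y : R -> X) (y' : X) :
  0 < k -> 0 <= s -> right_derivative y s y' -> opdom G (S (k * s) (y s)) ->
  right_derivative (fun t => S (k * t) (y t)) s
    (S (k * s) y' + k *: G (S (k * s) (y s))).
Proof.
move=> k0 s0 yd Gy.
have ks0 : 0 <= k * s by rewrite mulr_ge0// ltW.
have kc : k * (s + h) @[h --> 0^'+] --> k * s.
  apply: cvgM; first exact: cvg_cst.
  rewrite -[X in _ --> X]addr0; apply: cvgD; first exact: cvg_cst.
  by apply: cvg_at_right_filter; exact: cvg_id.
have kn : \forall h \near 0^'+, 0 <= k * (s + h).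
  by near=> h; rewrite mulr_ge0 ?addr_ge0 ?(ltW k0).
(* Product rule: the quotient is [S (k * (s + h))] applied to the quotient of [y], plus the quotient
   of the semigroup at time 0 applied to [S (k * s) (y s)]. *)
apply: near_cvg (cvgD (semigroup_cvg ks0 kn kc yd) (generator_cvg k0 Gy)).
near=> h.
have h0 : 0 < h by near: h; exact: nbhs_right_gt.
have kh0 : 0 <= k * h by rewrite mulr_ge0// ltW.
have ksh : 0 <= k * (s + h) by near: h.
rewrite semigroupZ// semigroupB// -scalerDr -semigroupD//.
by rewrite -mulrDr [h + s]addrC addrA subrK.
Unshelve. all: by end_near. Qed.

(** Since [S (b - s) = S (b - (s + h)) \o S h], the quotient is [S (b - (s + h))] applied to the
    quotient of [y] minus that of [h |-> S h (y s)]. Only [y s] has to lie in the domain of [G]. *)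
Lemma right_derivative_backward (b s : R) (y : R -> X) (y' : X) :
  0 <= s -> s < b -> right_derivative y s y' -> opdom G (y s) ->
  right_derivative (fun t => S (b - t) (y t)) s (S (b - s) (y' - G (y s))).
Proof.
move=> s0 sb yd Gy.
have bs : 0 <= b - s by rewrite subr_ge0 ltW.
have bc : b - (s + h) @[h --> 0^'+] --> b - s.
  apply: cvgB; first exact: cvg_cst.
  rewrite -[X in _ --> X]addr0; apply: cvgD; first exact: cvg_cst.
  by apply: cvg_at_right_filter; exact: cvg_id.
have bn : \forall h \near 0^'+, 0 <= b - (s + h).
  near=> h; rewrite opprD addrA subr_ge0; near: h.
  by apply: nbhs_right_le; rewrite subr_gt0.
case: S_generated => _ _ /(_ _ Gy) SG.
apply: near_cvg (semigroup_cvg bs bn bc (cvgB yd SG)).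
near=> h.
have h0 : 0 < h by near: h; exact: nbhs_right_gt.
have bsh : 0 <= b - (s + h) by near: h.
rewrite -scalerBr semigroupZ// opprB addrA subrK.
rewrite semigroupB// -semigroupD ?(ltW h0)//.
by congr (_ *: (_ - S _ _)); rewrite opprD addrA subrK.
Unshelve. all: by end_near. Qed.

Lemma left_continuous_semigroup (k s : R) (y : R -> X) :
  0 < k -> 0 < s -> left_continuous y s ->
  left_continuous (fun t => S (k * t) (y t)) s.
Proof.
move=> k0 s0 yl; apply: semigroup_cvg => //.
- by rewrite mulr_ge0// ltW.
- near=> t; have t0 : 0 < t by near: t; exact: nbhs_left_gt.
  by rewrite mulr_ge0 ?ltW.
- by apply: cvgM; [exact: cvg_cst|apply: cvg_at_left_filter; exact: cvg_id].
Unshelve. all: by end_near. Qed.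

Lemma left_continuous_backward (b s : R) (y : R -> X) :
  s <= b -> left_continuous y s -> left_continuous (fun t => S (b - t) (y t)) s.
Proof.
move=> sb yl; apply: semigroup_cvg => //.
- by rewrite subr_ge0.
- near=> t; rewrite subr_ge0 (le_trans _ sb)//.
- by apply: cvgB; [exact: cvg_cst|apply: cvg_at_left_filter; exact: cvg_id].
Unshelve. all: by end_near. Qed.

End Semigroups.

(** * Differentiable orbits and the expansion of commutators with a semigroup *)

Section Orbits.
Context {R : realType} {X : completeNormedModType R}.
Implicit Types (K G : operator X) (S : R -> X -> X).

Lemma right_derivative_orbit {K G S} {u : X} {t : R} : 0 <= t ->
  differentiable_orbit K G S u ->
  right_derivative (fun p => K (S p u)) t (K (G (S t u))).
Proof.
move=> t0 /(_ _ t0); apply: cvg_trans; apply: cvg_app => P.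
rewrite /within /= => -[d /= d0 dP]; exists d => // h hd h0; apply: dP => //.
  by rewrite gt_eqF.
by rewrite addr_ge0// ltW.
Qed.

Lemma left_continuous_orbit {K G S} {u : X} {t : R} : 0 < t ->
  differentiable_orbit K G S u -> left_continuous (fun p => K (S p u)) t.
Proof.
move=> t0 /(_ _ (ltW t0)) Kd; apply/subr_cvg0.
rewrite -(scale0r (K (G (S t u)))).
have xt : x - t @[x --> t^'-] --> within [set h | 0 <= t + h] 0^'.
  (* The bound by [t] keeps [x] nonnegative, so that the step [x - t] is admissible in the one-sided
     filter. *)
  move=> P [d /= d0 dP]; exists (Num.min d t); first by rewrite /= lt_min d0.
  move=> x /=; rewrite lt_min => /andP[xd xt] xlt; apply: dP.
  - by rewrite /= sub0r opprB.
  - by rewrite subr_eq0 lt_eqF.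
  - rewrite /= addrC subrK; move: xt; rewrite gtr0_norm ?subr_gt0//; lra.
have xt0 : x - t @[x --> t^'-] --> 0.
  by apply/subr_cvg0; apply: cvg_at_left_filter; exact: cvg_id.
apply: near_cvg (cvgZ xt0 (cvg_comp _ _ xt Kd)).
near=> x; rewrite /= scalerA mulfV ?scale1r; first by rewrite [t + _]addrC subrK.
by rewrite subr_eq0; near: x; exact: nbhs_left_neq.
Unshelve. all: by end_near. Qed.

(* [right_taylor] for [p |-> S (b - p) (K (S p u))] on [[0, b]], whose right
   derivative at [p] is [eta *: S (b - p) (C (S p u))]. *)
Lemma semigroup_commutator_expansion {K C G : operator X} {S} {mu : R}
    {u : X} {M eta b : R} :
  generates G S ->
  (forall t, 0 <= t -> (opnorm (everywhere (S t)) <= (expR (t * mu))%:E)%E) ->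
  0 <= b -> 0 <= M ->
  differentiable_orbit K G S u -> differentiable_orbit C G S u ->
  (forall p, 0 <= p -> let w := S p u in
    [/\ opdom G (K w), opdom G (C w), K (G w) - G (K w) = eta *: C w &
        `|C (G w) - G (C w)| <= M * `|w|]) ->
  let m := `|eta| * (expR (b * mu) * M * `|u|) * b ^+ 2 / 2 in
  `|K (S b u) - S b (K u) - (eta * b) *: S b (C u)| <= m /\
  `|K (S b u) - S b (K u) - (eta * b) *: C (S b u)| <= m.
Proof.
move=> gS Sg b0 M0 Kd Cd KC m; have [Sc _ _] := gS.
pose f p := S (b - p) (K (S p u)).
pose g p := eta *: S (b - p) (C (S p u)).
pose g' p := eta *: S (b - p) (C (G (S p u)) - G (C (S p u))).
have := @right_taylor R X f g g' (`|eta| * (expR (b * mu) * M * `|u|)) 0 b b0.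
rewrite /f /g subrr !subr0 (semigroup0 Sc) (semigroup0 Sc).
rewrite !(semigroup0 Sc) !scalerA [b * eta]mulrC => H; apply: H.
- move=> x /andP[x0 xb]; split.
    by apply: (left_continuous_backward (mu := mu)) => //; exact: left_continuous_orbit Kd.
  apply: cvgZ; first exact: cvg_cst.
  by apply: (left_continuous_backward (mu := mu)) => //; exact: left_continuous_orbit Cd.
- move=> x /andP[x0 xb]; have [GK _ KG _] := KC _ x0.
  rewrite -(semigroupZ Sc) ?subr_ge0 ?ltW// -KG.
  by apply: (right_derivative_backward (mu := mu)) => //; exact: right_derivative_orbit.
- move=> x /andP[x0 xb]; have [_ GC _ _] := KC _ x0.
  apply: right_derivativeZ.
  by apply: (right_derivative_backward (mu := mu)) => //; exact: right_derivative_orbit.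
- move=> x /andP[x0 xb]; have [_ _ _ CG] := KC _ x0.
  have bx : 0 <= b - x by rewrite subr_ge0 ltW.
  rewrite normrZ ler_wpM2l//.
  rewrite (le_trans (semigroup_norm_le Sc Sg _ _))//.
  (* The growth over [b - x] and over [x] multiply to [expR (b * mu)], so the bound does not depend
     on [x]. *)
  have -> : b * mu = (b - x) * mu + x * mu by rewrite -mulrDl subrK.
  rewrite expRD -!mulrA ler_wpM2l ?expR_ge0// (le_trans CG)//.
  by rewrite mulrCA ler_wpM2l// semigroup_norm_le.
Qed.

End Orbits.

(** * The scalar factor of the error bound *)

(** Together with its value 0 at 0, this identifies the factor as the integral of
    [x ^+ 2 * expR (omega * x) / 2] over [[0, t]], uniformly in [omega], and makes it usable as
    comparison function in the mean value inequality. *)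
Lemma is_derive_strang_factor {R : realType} (omega x : R) :
  is_derive x 1 (strang_factor omega) (x ^+ 2 * expR (omega * x) / 2).
Proof.
have [->|w0] := eqVneq omega 0.
  have -> : strang_factor 0 = fun y : R => y ^+ 3 / 6.
    by apply/funext => y; rewrite /strang_factor eqxx.
  by rewrite mul0r expR0; apply: is_derive_eq; rewrite /GRing.scale/=; field.
have -> : strang_factor omega = fun y : R =>
    ((1 - omega * y + omega ^+ 2 * y ^+ 2 / 2) * expR (omega * y) - 1) / omega ^+ 3.
  by apply/funext => y; rewrite /strang_factor (negbTE w0).
have ed : is_derive x 1 (fun y : R => expR (omega * y)) (expR (omega * x) * omega).
  have d1 : is_derive x 1 ( *%R omega) omega.
    by apply: is_derive_eq; rewrite [_ *: _]mulr1.
  exact: (is_derive1_comp (f := expR) (g := *%R omega)).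
by apply: is_derive_eq; rewrite /GRing.scale/=; field.
Qed.

Lemma strang_factor0 {R : realType} (omega : R) : strang_factor omega 0 = 0.
Proof.
rewrite /strang_factor; case: ifP => _; first by rewrite expr0n mul0r.
by rewrite expr0n !mulr0 mul0r subr0 expR0 addr0 mulr1 subrr mul0r.
Qed.

(** The derivative is nonnegative and the value at 0 is 0; the mean value inequality for the zero
    function concludes. *)
Lemma strang_factor_ge0 {R : realType} (omega t : R) :
  0 <= t -> 0 <= strang_factor omega t.
Proof.
move=> t0.
have := @right_derivative_norm_le R R^o (fun=> 0) (fun=> 0) (strang_factor omega)
  (fun x => x ^+ 2 * expR (omega * x) / 2) 0 t t0.
rewrite subrr normr0 strang_factor0 subr0; apply.
- by move=> x _; exact: cvg_cst.
- by move=> x _; exact: right_derivative_cst.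
- exact: is_derive_strang_factor.
- by move=> x _; rewrite divr_ge0// mulr_ge0 ?sqr_ge0 ?expR_ge0.
Qed.

(** * Defect and error of the Strang splitting on the strang domain *)

Section Strang.
Context {R : realType} {X : completeNormedModType R}.
Context (A B : operator X) (SA SB : R -> X -> X) (muA muB MA MB : R).
Hypothesis (hSA : generates A SA) (hSB : generates B SB).
Hypothesis growthA : forall t : R, 0 <= t ->
  (opnorm (everywhere (SA t)) <= (expR (t * muA))%:E)%E.
Hypothesis growthB : forall t : R, 0 <= t ->
  (opnorm (everywhere (SB t)) <= (expR (t * muB))%:E)%E.
Hypothesis (MA0 : 0 <= MA) (MB0 : 0 <= MB).
Let AB := commutator A B.
Hypothesis boundA : forall w, opdom (commutator A AB) w ->
  `|commutator A AB w| <= MA * `|w|.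
Hypothesis boundB : forall w, opdom (commutator B AB) w ->
  `|commutator B AB w| <= MB * `|w|.
Context (u : X).
Hypothesis hu : strang_domain A B SA SB u.

Let semiA : C0_semigroup SA. Proof. by case: hSA. Qed.
Let semiB : C0_semigroup SB. Proof. by case: hSB. Qed.

Lemma strang_domain_opdom (p q s : R) : 0 <= p -> 0 <= q -> 0 <= s ->
  let w := SA p (SB q (SA s u)) in
  opdom (commutator A AB) w /\ opdom (commutator B AB) w.
Proof. by move=> p0 q0 s0; have [_ _ /(_ _ q0)[_ _ /(_ _ p0)]] := hu s0. Qed.

Let half := 2^-1 : R.
Definition strang_w s := SA (half * s) u.
Definition strang_v s := SB (1 * s) (strang_w s).
Definition strang_flow s := SA (half * s) (strang_v s).
(* [strang_flow' - (A + B) strang_flow]; the factors [1] and the term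
   [SA (half * s) 0] are what three uses of [right_derivative_semigroup] produce. *)
Definition strang_defect s :=
  SA (half * s) (SB (1 * s) (SA (half * s) 0 + half *: A (strang_w s))
                 + 1 *: B (strang_v s))
  + half *: A (strang_flow s) - (A (strang_flow s) + B (strang_flow s)).

Let half_gt0 : 0 < half. Proof. by rewrite invr_gt0. Qed.
Let half_ge0 (s : R) : 0 <= s -> 0 <= half * s.
Proof. by move=> s0; rewrite mulr_ge0// ltW. Qed.

Lemma strang_w_opdom (s : R) : 0 <= s ->
  opdom (commutator A AB) (strang_w s) /\ opdom (commutator B AB) (strang_w s).
Proof.
move=> s0; have := strang_domain_opdom (lexx 0) (lexx 0) (half_ge0 s0).
by rewrite /= (semigroup0 semiA) (semigroup0 semiB).
Qed.

Lemma strang_v_opdom (s : R) : 0 <= s ->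
  opdom (commutator A AB) (strang_v s) /\ opdom (commutator B AB) (strang_v s).
Proof.
move=> s0; have := strang_domain_opdom (lexx 0) s0 (half_ge0 s0).
by rewrite /= (semigroup0 semiA) /strang_v mul1r.
Qed.

Lemma strang_flow_opdom (s : R) : 0 <= s ->
  opdom (commutator A AB) (strang_flow s) /\ opdom (commutator B AB) (strang_flow s).
Proof.
move=> s0; have := strang_domain_opdom (half_ge0 s0) s0 (half_ge0 s0).
by rewrite /strang_flow /strang_v mul1r.
Qed.

Lemma commutatorA_opdom w : opdom (commutator A AB) w -> opdom A w.
Proof. by case=> _ []. Qed.

Lemma commutatorB_opdom w : opdom (commutator B AB) w -> opdom B w.
Proof. by case=> _ []. Qed.

(** The product rule is applied three times, from the outermost factor inwards, down to the constant
    [u]. *)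
Lemma right_derivative_strang_flow (s : R) : 0 <= s ->
  right_derivative strang_flow s
    (strang_defect s + (A (strang_flow s) + B (strang_flow s))).
Proof.
move=> s0; rewrite /strang_defect subrK.
apply: (right_derivative_semigroup semiA growthA hSA) => //; last first.
  exact: commutatorA_opdom (strang_flow_opdom s0).1.
apply: (right_derivative_semigroup semiB growthB hSB) => //; last first.
  exact: commutatorB_opdom (strang_v_opdom s0).2.
apply: (right_derivative_semigroup semiA growthA hSA) => //; last first.
  exact: commutatorA_opdom (strang_w_opdom s0).1.
exact: right_derivative_cst.
Qed.

Lemma left_continuous_strang_flow (s : R) : 0 < s -> left_continuous strang_flow s.
Proof.
move=> s0; apply: (left_continuous_semigroup semiA growthA) => //.
apply: (left_continuous_semigroup semiB growthB) => //.
apply: (left_continuous_semigroup semiA growthA) => //.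
exact: cvg_cst.
Qed.

(** The [A] remainder over a half step contributes [(s / 2) ^+ 2 / 2 = s ^+ 2 / 8]; the [B]
    remainder over a full step, halved, contributes [s ^+ 2 / 4]. This explains both the 8 and the
    weight 2 of [MB]. *)
Lemma strang_defect_norm_le (s : R) : 0 <= s ->
  `|strang_defect s| <=
    (MA + 2 * MB) * `|u| / 8 * s ^+ 2 * expR (s * (muA + muB)).
Proof.
move=> s0; set sg := half * s; have sg0 : 0 <= sg := half_ge0 s0.
set w := strang_w s; set v := strang_v s; set c := strang_flow s.
have [dA dC dv] := hu sg0.
have [dB dC' _] := dv s s0.
have vE : v = SB s w by rewrite /v /strang_v mul1r.
(* Expansion with [K = B] and [G = A]; here [BA - AB] is minus [[A,B]], hence [eta = -1]. The
   endpoint chosen has [[A,B]] acting on [v]. *)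
have X1 : `|B c - SA sg (B v) - (-1 * sg) *: SA sg (AB v)| <=
    expR (sg * muA) * MA * `|v| * sg ^+ 2 / 2.
  have := semigroup_commutator_expansion (M := MA) (eta := -1) hSA growthA sg0 MA0 dB dC'.
  rewrite -vE normrN normr1 mul1r => H; apply: (H _).1 => p p0 /=.
  have [dAp dBp] := strang_domain_opdom p0 s0 sg0.
  have -> : SA p v = SA p (SB s (SA sg u)) by rewrite vE.
  have [[[[_ ?] _] ?] _] := dAp; split => //.
  - by rewrite scaleN1r opprB.
  - by rewrite distrC; exact: boundA.
(* Expansion with [K = A] and [G = B], at the other endpoint, so that [[A,B]] again acts on [v]. *)
have X2 : `|A v - SB s (A w) - (1 * s) *: AB v| <=
    expR (s * muB) * MB * `|w| * s ^+ 2 / 2.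
  have := semigroup_commutator_expansion (M := MB) (eta := 1) hSB growthB s0 MB0 dA dC.
  rewrite -/(strang_w s) -/w -vE normr1 mul1r => H; apply: (H _).2 => p p0 /=.
  have := strang_domain_opdom (lexx 0) p0 sg0.
  rewrite /= (semigroup0 semiA) -/(strang_w s) -/w => -[dAp dBp].
  have [[[_ [_ ?]] ?] _] := dBp; split => //.
  - by rewrite scale1r.
  - by rewrite distrC; exact: boundB.
(* Half of [A c] remains in the defect with a minus sign; in this form it pairs with the term in
   [A w] to give the commutator of [A] with [SB s]. *)
have Ac : A c = SA sg (A v).
  apply: (generator_commute semiA growthA hSA) => //.
    exact: commutatorA_opdom (strang_v_opdom s0).1.
  exact: commutatorA_opdom (strang_flow_opdom s0).1.
(* The first-order terms [half * s *: SA sg (AB v)] of the two expansions, taken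
   at opposite endpoints, cancel. *)
have defectE y : strang_defect s = - (B c - SA sg (B v) - (-1 * sg) *: SA sg y)
    - half *: SA sg (A v - SB s (A w) - (1 * s) *: y).
  have SA0 : SA sg 0 = 0.
    by rewrite -[X in SA _ X](scale0r 0) (semigroupZ semiA)// scale0r.
  have SAD x1 x2 : SA sg (x1 + x2) = SA sg x1 + SA sg x2.
    by have := semigroup_linear semiA sg0 1 x1 x2; rewrite !scale1r.
  rewrite /strang_defect -/sg -/c -/v -/w SA0 add0r !mul1r !scale1r SAD.
  rewrite !(semigroupB semiA)// !(semigroupZ semiB)// !(semigroupZ semiA)// -Ac.
  rewrite mulN1r scaleNr opprK !scalerBr -/sg /sg -scalerA.
  have rr : A c = half *: A c + half *: A c.
    by rewrite -scalerDl -[half]mul1r -splitr scale1r.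
  rewrite [in X in _ - X = _]rr.
  move: (SA _ (B v)) (B c) (half *: A c) (half *: (s *: _)) (half *: SA _ _).
  move=> p q r e z; rewrite !opprD !opprK !addrA addrK.
  rewrite [_ - e - r]addrAC [_ - e + z]addrAC subrK addrC !addrA.
  by rewrite [RHS]addrAC [- q + p + z]addrAC.
rewrite (defectE (AB v)).
apply: (le_trans (ler_normB _ _)); rewrite normrN normrZ gtr0_norm//.
have X2' := ler_wpM2l (ltW half_gt0) (semigroup_norm_le semiA growthA _ sg0).
apply: (le_trans (lerD X1 (X2' _))).
have ew : `|w| <= expR (sg * muA) * `|u| by apply: (semigroup_norm_le semiA growthA).
have ev : `|v| <= expR (s * muB) * `|w|.
  by rewrite vE; apply: (semigroup_norm_le semiB growthB).
(* The three factors are the growth of the outer half step, the [B] step and the inner half step. *)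
have -> : expR (s * (muA + muB)) = expR (sg * muA) * expR (s * muB) * expR (sg * muA).
  by rewrite -!expRD; congr expR; rewrite /sg /half; field.
have a0 : 0 <= expR (sg * muA) by exact: expR_ge0.
have b0 : 0 <= expR (s * muB) by exact: expR_ge0.
set a := expR (sg * muA) in a0 ew X1 *; set b := expR (s * muB) in b0 ev X2 *.
have ev' := le_trans ev (ler_wpM2l b0 ew).
have s20 : 0 <= s ^+ 2 / 2 by rewrite divr_ge0// sqr_ge0.
have sg20 : 0 <= sg ^+ 2 / 2 by rewrite divr_ge0// sqr_ge0.
apply: (@le_trans _ _ (a * MA * (b * (a * `|u|)) * (sg ^+ 2 / 2) +
    half * (a * (b * MB * (a * `|u|) * (s ^+ 2 / 2))))); last first.
  by rewrite /sg /half le_eqVlt; apply/orP; left; apply/eqP; field.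
apply: lerD; first by rewrite -mulrA ler_wpM2r// ler_wpM2l// mulr_ge0.
rewrite ler_wpM2l ?(ltW half_gt0)// ler_wpM2l// (le_trans X2)//.
by rewrite -mulrA ler_wpM2r// ler_wpM2l// mulr_ge0.
Qed.

Context (SAB : R -> X -> X) (muAB : R).
Hypothesis hSAB : generates (op_add A B) SAB.
Hypothesis growthAB : forall t : R, 0 <= t ->
  (opnorm (everywhere (SAB t)) <= (expR (t * muAB))%:E)%E.

Lemma strang_error_norm_le (t : R) : 0 <= t ->
  `|strang_error SA SB SAB t u| <=
    4^-1 * expR (t * muAB) * strang_factor (muA + muB - muAB) t *
      (MA + 2 * MB) * `|u|.
Proof.
move=> t0; set omega := muA + muB - muAB; have [semiAB _ _] := hSAB.
(* The derivative of [strang_factor] carries a factor 1/2, so 1/4 here matches the 1/8 of the defect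
   bound. *)
pose c := 4^-1 * expR (t * muAB) * ((MA + 2 * MB) * `|u|).
have flow0 : strang_flow 0 = u.
  rewrite /strang_flow /strang_v /strang_w !mulr0.
  by rewrite !(semigroup0 semiA) (semigroup0 semiB).
have flowt : strang_flow t = SA (t / 2) (SB t (SA (t / 2) u)).
  by rewrite /strang_flow /strang_v /strang_w mul1r [half * t]mulrC.
have := @right_derivative_norm_le R X (fun x => SAB (t - x) (strang_flow x))
  (fun x => SAB (t - x) (strang_defect x)) (fun x => c * strang_factor omega x)
  (fun x => c * (x ^+ 2 * expR (omega * x) / 2)) 0 t t0.
rewrite subrr subr0 flow0 (semigroup0 semiAB) flowt strang_factor0 mulr0 subr0.
have -> : c * strang_factor omega t = 4^-1 * expR (t * muAB) * strang_factor omega t *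
    (MA + 2 * MB) * `|u| by rewrite /c; ring.
apply.
- move=> x /andP[x0 xt]; apply: (left_continuous_backward semiAB growthAB) => //.
  exact: left_continuous_strang_flow.
- move=> x /andP[x0 xt].
  have := right_derivative_backward semiAB growthAB hSAB x0 xt
    (right_derivative_strang_flow x0).
  (* The backward semigroup subtracts [A + B] applied to the flow, so only the defect is left in the
     derivative. *)
  rewrite /= addrK; apply; split.
    exact: commutatorA_opdom (strang_flow_opdom x0).1.
  exact: commutatorB_opdom (strang_flow_opdom x0).2.
- move=> x; have d := is_derive_strang_factor omega x.
  by apply: is_derive_eq; rewrite /GRing.scale/=; ring.
- move=> x /andP[x0 xt]; have tx : 0 <= t - x by rewrite subr_ge0 ltW.
  rewrite (le_trans (semigroup_norm_le semiAB growthAB _ tx))//.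
  rewrite (le_trans (ler_wpM2l (expR_ge0 _) (strang_defect_norm_le x0)))//.
  (* This identity is the origin of [omega]: the excess of the splitting's growth rate over
     [muAB]. *)
  have e : expR (t * muAB) * expR (omega * x) =
      expR ((t - x) * muAB) * expR (x * (muA + muB)).
    by rewrite -!expRD; congr expR; rewrite /omega; ring.
  rewrite le_eqVlt; apply/orP; left; apply/eqP.
  transitivity (8^-1 * ((MA + 2 * MB) * `|u|) * x ^+ 2 *
     (expR ((t - x) * muAB) * expR (x * (muA + muB)))); first by field.
  by rewrite -e /c; field.
Qed.

End Strang.

(** * Extension to the whole space by density *)

Unset Implicit Arguments.

Theorem mainTheorem5
  (R : realType) (X : completeNormedModType R) (ip : {dot X for @idfun R})
  (hX : hilbert_inner_product ip)
  (A B : operator X) (hA : linear_operator A) (hB : linear_operator B)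
  (SA SB SAB : R -> X -> X)
  (hSA : generates A SA) (hSB : generates B SB)
  (hSAB : generates (op_add A B) SAB)
  (muA muB muAB : R)
  (hmuA : is_log_norm SA muA) (hmuB : is_log_norm SB muB)
  (hmuAB : is_log_norm SAB muAB)
  (hAAB : op_bounded (commutator A (commutator A B)))
  (hBAB : op_bounded (commutator B (commutator A B)))
  (hdense : dense (strang_domain A B SA SB)) :
  let omega := muA + muB - muAB in
  let N := (opnorm (commutator A (commutator A B))
            + 2%:E * opnorm (commutator B (commutator A B)))%E in
  (forall t : R, 0 <= t ->
     (opnorm (strang_error SA SB SAB t)
      <= (4^-1 * expR (t * muAB) * strang_factor omega t)%:E * N)%E)
  /\
  (muA = 0 -> muB = 0 -> muAB = 0 ->
   forall t : R, 0 <= t ->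
     (opnorm (strang_error SA SB SAB t) <= (t ^+ 3 / 24)%:E * N)%E).
Proof.
move=> omega N.
have linAB := linear_operator_commutator hA hB.
have linAAB := linear_operator_commutator hA linAB.
have linBAB := linear_operator_commutator hB linAB.
have [MA [MA0 MAE]] := opnorm_fin linAAB hAAB.
have [MB [MB0 MBE]] := opnorm_fin linBAB hBAB.
have NE : N = (MA + 2 * MB)%:E by rewrite /N MAE MBE.
have main (t : R) : 0 <= t ->
    (opnorm (strang_error SA SB SAB t)
      <= (4^-1 * expR (t * muAB) * strang_factor omega t)%:E * N)%E.
  move=> t0; rewrite NE -EFinM.
  set M := _ * (MA + 2 * MB).
  have M0 : 0 <= M.
    by rewrite !mulr_ge0 ?expR_ge0 ?strang_factor_ge0// addr_ge0// mulr_ge0.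
  apply: opnorm_le M0 _ => v _; rewrite leNgt; apply/negP => vM.
  have t20 : 0 <= t / 2 by rewrite divr_ge0.
  have [[SAc _ _ _] _ _] := hSA; have [[SBc _ _ _] _ _] := hSB.
  have [[SABc _ _ _] _ _] := hSAB.
  have Ec : continuous (fun w => `|strang_error SA SB SAB t w| - M * `|w|).
    move=> w; apply: cvgB; last by apply: cvgM; [exact: cvg_cst|exact: norm_continuous].
    apply: cvg_norm; apply: cvgB; last exact: (SABc _ t0).2.
    apply: (continuous_comp (g := SA (t / 2))); last exact: (SAc _ t20).2.
    by apply: (continuous_comp (g := SB t)); [exact: (SAc _ t20).2|exact: (SBc _ t0).2].
  (* A violation at [v] makes this open set nonempty, so by density it contains an element of the
     strang domain, where the bound is already known. *)
  have Eo : open [set w | 0 < `|strang_error SA SB SAB t w| - M * `|w|].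
    exact: ((continuousP _).1 Ec _ (@open_gt R 0)).
  have [|w [/= wM wD]] := hdense _ _ Eo; first by exists v; rewrite /= subr_gt0.
  move: wM; rewrite subr_gt0 ltNge => /negP; apply.
  apply: (strang_error_norm_le hSA hSB _ _ MA0 MB0 _ _ wD hSAB) => //.
  - exact: hmuA.1.
  - exact: hmuB.1.
  - by move=> x Dx; apply: (norm_le_opnorm linAAB); rewrite ?MAE.
  - by move=> x Dx; apply: (norm_le_opnorm linBAB); rewrite ?MBE.
  - exact: hmuAB.1.
split=> // A0 B0 AB0 t t0; have := main t t0.
rewrite /omega A0 B0 AB0 addr0 subr0 mulr0 expR0 mulr1 /strang_factor eqxx.
by have -> : 4^-1 * (t ^+ 3 / 6) = t ^+ 3 / 24 by field.
Qed.
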